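(* Let $(X,r)$ be a quantum binomial set, i.e. a quadratic set which is non-degenerate, involutive and square-free. Then the following conditions are equivalent: (1) $(X,r)$ is a set-theoretic solution of the Yang-Baxter equation; (2) $(X,r)$ satisfies $\mathbf{l1}$; (3) $(X,r)$ satisfies $\mathbf{l2}$; (4) $(X,r)$ satisfies $\mathbf{r1}$; (5) $(X,r)$ satisfies $\mathbf{r2}$; (6) $(X,r)$ satisfies $\mathbf{lr3}$; (7) $(X,r)$ satisfies $\mathbf{csl}$. In this case $(X,r)$ is cyclic and satisfies $\mathbf{lri}$.
   Context: A quadratic set $(X,r)$ is a nonempty set $X$ (possibly infinite) with a bijective map $r:X\times X\to X\times X$. Write $r(x,y)=({}^xy,x^y)$, and $\mathcal L_x(y)={}^xy$, $\mathcal R_y(x)=x^y$. $r$ is non-degenerate if all $\mathcal L_x,\mathcal R_x$ are bijections of $X$; involutive if $r^2=\mathrm{id}$; square-free if $r(x,x)=(x,x)$ for all $x$. $r$ is a set-theoretic solution of the Yang-Baxter equation if $r^{12}r^{23}r^{12}=r^{23}r^{12}r^{23}$ on $X^3$, where $r^{12}=r\times\mathrm{id}$, $r^{23}=\mathrm{id}\times r$. Extend the actions to $X\times X$ by ${}^x(y,z):=({}^xy,{}^{x^y}z)$ and $(x,y)^z:=(x^{{}^yz},y^z)$. The following conditions are each required for all $x,y,z,t\in X$: - $\mathbf{l1}$: ${}^x({}^yz)={}^{{}^xy}({}^{x^y}z)$; - $\mathbf{r1}$: $(x^y)^z=(x^{{}^yz})^{y^z}$; - $\mathbf{lr3}$: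 $({}^xy)^{({}^{x^y}z)}={}^{(x^{{}^yz})}(y^z)$; - $\mathbf{l2}$: $r({}^x(y,z))={}^x(r(y,z))$; - $\mathbf{r2}$: $r((x,y)^z)=(r(x,y))^z$; - $\mathbf{csl}$: ${}^{({}^yt)}({}^yx)={}^{({}^ty)}({}^tx)$; - $\mathbf{lri}$: $({}^xy)^x=y={}^x(y^x)$. $(X,r)$ is cyclic if for all $x,y\in X$: ${}^{y^x}x={}^yx$, $x^{{}^xy}=x^y$, ${}^{{}^xy}x={}^yx$, and $x^{y^x}=x^y$. *)

(* Defs.v *)
From mathcomp Require Import all_boot.

Set Implicit Arguments.
Unset Strict Implicit.
Unset Printing Implicit Defensive.

Section QuadraticSet.
Variables (X : Type) (r : X * X -> X * X).

Definition quadratic_set : Prop := inhabited X /\ bijective r.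

(* [lact x y] is the left action ^x y and [ract x y] the right action x^y,
   that is, r (x, y) = (^x y, x^y). *)
Definition lact (x y : X) : X := (r (x, y)).1.
Definition ract (x y : X) : X := (r (x, y)).2.

Definition nondegenerate : Prop :=
  (forall x, bijective (fun y => lact x y)) /\
  (forall y, bijective (fun x => ract x y)).

Definition square_free : Prop := forall x, r (x, x) = (x, x).

Definition quantum_binomial_set : Prop :=
  [/\ quadratic_set, nondegenerate, involutive r & square_free].

Definition r12 (t : X * X * X) : X * X * X :=
  let: (x, y, z) := t in (lact x y, ract x y, z).
Definition r23 (t : X * X * X) : X * X * X :=
  let: (x, y, z) := t in (x, lact y z, ract y z).

Definition yang_baxter : Prop := r12 \o r23 \o r12 =1 r23 \o r12 \o r23.

(* The actions of X on X * X: ^x (y, z) = (^x y, ^(x^y) z) and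
   (x, y)^z = (x^(^y z), y^z). *)
Definition lact2 (x : X) (p : X * X) : X * X :=
  (lact x p.1, lact (ract x p.1) p.2).
Definition ract2 (p : X * X) (z : X) : X * X :=
  (ract p.1 (lact p.2 z), ract p.2 z).

Definition cond_l1 : Prop := forall x y z,
  lact x (lact y z) = lact (lact x y) (lact (ract x y) z).

Definition cond_r1 : Prop := forall x y z,
  ract (ract x y) z = ract (ract x (lact y z)) (ract y z).

Definition cond_lr3 : Prop := forall x y z,
  ract (lact x y) (lact (ract x y) z) = lact (ract x (lact y z)) (ract y z).

Definition cond_l2 : Prop := forall x y z,
  r (lact2 x (y, z)) = lact2 x (r (y, z)).

Definition cond_r2 : Prop := forall x y z,
  r (ract2 (x, y) z) = ract2 (r (x, y)) z.

Definition cond_csl : Prop := forall x y t,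
  lact (lact y t) (lact y x) = lact (lact t y) (lact t x).

Definition cond_lri : Prop := forall x y,
  ract (lact x y) x = y /\ lact x (ract y x) = y.

Definition cyclic_quadratic_set : Prop := forall x y,
  [/\ lact (ract y x) x = lact y x,
      ract x (lact x y) = ract x y,
      lact (lact x y) x = lact y x &
      ract x (ract y x) = ract x y].

End QuadraticSet.

(* Main.v *)
Require Import Defs.
From mathcomp Require Import all_boot.

Set Implicit Arguments.
Unset Strict Implicit.
Unset Printing Implicit Defensive.

(** Write F = r12 r23 r12 and G = r23 r12 r23; both are involutions of X^3.
    Conditions l1, lr3, r1 say that F and G have the same first, middle, last
    component, so YBE is their conjunction, l2 is l1 and lr3, r2 is r1 and lr3.

    Since r is involutive with injective actions, l1 and r1 each imply lr3.
    In turn lr3 alone gives YBE: it makes both GF and FG preserve the middle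
    component, and r12 (GF) = (FG) r12, r23 (GF) = (FG) r23, so the middle
    components of r12 t and r23 t are unchanged when t is replaced by GF t;
    injectivity of the actions then yields GF t = t.

    Square-freeness enters in the comparison with csl: l1 at (x, y, x^y) gives
    ^x(^y(x^y)) = x = ^x x, which is lri, and hence the cyclic conditions, while
    csl at x = t gives the cyclic condition ^(^t y) t = ^y t. In either case l1
    at (^y t, y, x) reads as csl. *)

Section InvolutiveQuadraticSet.
Variables (X : Type) (r : X * X -> X * X).
Hypothesis r_inv : involutive r.

Local Notation L := (lact r).
Local Notation R := (ract r).

Lemma lact_ract_involutive x y : L (L x y) (R x y) = x.
Proof.
by rewrite {1}/lact -[(_, R x y)]surjective_pairing r_inv.
Qed.

Lemma ract_lact_involutive x y : R (L x y) (R x y) = y.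
Proof.
by rewrite {1}/ract -[(_, R x y)]surjective_pairing r_inv.
Qed.

Lemma r12_involutive : involutive (r12 r).
Proof.
by move=> [[x y] z]; rewrite /= lact_ract_involutive ract_lact_involutive.
Qed.

Lemma r23_involutive : involutive (r23 r).
Proof.
by move=> [[x y] z]; rewrite /= lact_ract_involutive ract_lact_involutive.
Qed.

Lemma yang_baxter_l1 : yang_baxter r -> cond_l1 r.
Proof. by move=> yb x y z; have [-> _ _] := yb (x, y, z). Qed.

Lemma yang_baxter_r1 : yang_baxter r -> cond_r1 r.
Proof. by move=> yb x y z; have [_ _ ->] := yb (x, y, z). Qed.

Lemma l2P : cond_l2 r <-> cond_l1 r /\ cond_lr3 r.
Proof.
split=> [l2 | [l1 lr3] x y z].
  split=> x y z; first exact: esym (congr1 fst (l2 x y z)).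
  exact: (congr1 snd (l2 x y z)).
rewrite /lact2 /= -/(L y z) -/(R y z) l1 -lr3.
exact: surjective_pairing.
Qed.

Lemma r2P : cond_r2 r <-> cond_r1 r /\ cond_lr3 r.
Proof.
split=> [r2 | [r1 lr3] x y z].
  split=> x y z; first exact: esym (congr1 snd (r2 x y z)).
  exact: esym (congr1 fst (r2 x y z)).
rewrite /ract2 /= -/(L x y) -/(R x y) r1 lr3.
exact: surjective_pairing.
Qed.

Hypothesis L_inj : forall x, injective (L x).
Hypothesis R_inj : forall y, injective (R^~ y).

(** Applying [L (L x (L y z))] turns both sides into [L x y]. *)
Lemma l1_lr3 : cond_l1 r -> cond_lr3 r.
Proof.
move=> l1 x y z; apply: (@L_inj (L x (L y z))).
by rewrite -l1 lact_ract_involutive l1 lact_ract_involutive.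
Qed.

Lemma r1_lr3 : cond_r1 r -> cond_lr3 r.
Proof.
move=> r1 x y z; apply: (@R_inj (R (R x y) z)).
by rewrite /= -r1 ract_lact_involutive r1 ract_lact_involutive.
Qed.

Lemma lr3_yang_baxter : cond_lr3 r -> yang_baxter r.
Proof.
move=> lr3.
set F := r12 r \o r23 r \o r12 r; set G := r23 r \o r12 r \o r23 r.
have FK : involutive F.
  by move=> t; rewrite /F /= r12_involutive r23_involutive r12_involutive.
have GK : involutive G.
  by move=> t; rewrite /G /= r23_involutive r12_involutive r23_involutive.
have midFG t : (F t).1.2 = (G t).1.2 by case: t => [[x y] z]; exact: lr3.
have midFGid t : (F (G t)).1.2 = t.1.2 by rewrite midFG GK.
suff GFK t : G (F t) = t by move=> t; rewrite -[RHS]/(G t) -[in RHS](FK t) GFK.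
have mid0 : (G (F t)).1.2 = t.1.2 by rewrite -midFG FK.
have mid12 : (r12 r (G (F t))).1.2 = (r12 r t).1.2.
  (* [r12 \o G \o F] and [F \o G \o r12] are the same alternating word, so conversion suffices. *)
  by rewrite -[RHS]midFGid.
have mid23 : (r23 r (G (F t))).1.2 = (r23 r t).1.2.
  by rewrite -[RHS]midFGid /F /G /= !r23_involutive.
case: t (G _) mid0 mid12 mid23 => [[x y] z] [[x' y'] z'] /= -> eq_x eq_z.
by rewrite (R_inj eq_x) (L_inj eq_z).
Qed.

End InvolutiveQuadraticSet.

Section SquareFree.
Variables (X : Type) (r : X * X -> X * X).
Hypotheses (r_inv : involutive r) (r_sqf : square_free r).

Local Notation L := (lact r).
Local Notation R := (ract r).

Hypothesis L_bij : forall x, bijective (L x).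

Let L_inj x : injective (L x) := bij_inj (L_bij x).

Lemma lact_square_free x : L x x = x.
Proof. by rewrite /lact r_sqf. Qed.

Lemma l1_lri : cond_l1 r -> cond_lri r.
Proof.
move=> l1; have lri2 x y : L x (R y x) = y.
  apply: (@L_inj y).
  by rewrite l1 !lact_square_free lact_ract_involutive.
by move=> x y; split=> //; apply: (@L_inj x); rewrite lri2.
Qed.

Lemma lri_cyclic : cond_lri r -> cyclic_quadratic_set r.
Proof.
move=> lri; have lri1 x y : R (L x y) x = y by case: (lri x y).
have lri2 x y : L x (R y x) = y by case: (lri x y).
have cyc1 x y : L (R y x) x = L y x.
  (* Here [lri2] is used at the pair [R y x], [L y x], since [R (L y x) (R y x)] is [x]. *)
  by rewrite -[RHS](lri2 (R y x)) ract_lact_involutive.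
have cyc2 x y : R x (L x y) = R x y.
  by apply: (@L_inj (L x y)); rewrite lri2 lact_ract_involutive.
move=> x y; split=> //; first by rewrite -cyc1 lri1.
by rewrite -cyc2 lri2.
Qed.

Lemma l1_csl : cond_l1 r -> cond_csl r.
Proof.
move=> l1 x y t; have lri := l1_lri l1.
have [_ _ cyc _] := lri_cyclic lri y t.
by rewrite l1 cyc (lri y t).1.
Qed.

Lemma csl_l1 : cond_csl r -> cond_l1 r.
Proof.
move=> csl.
have cyc t y : L (L t y) t = L y t.
  by rewrite -{2}(lact_square_free t) -csl lact_square_free.
move=> x y w; have [K _ LK] := L_bij y.
(* With [x] written as [L y z], two uses of [cyc] give [L (L x y) z = x]. Hence [R x y] is [z], and
   l1 becomes csl up to one more [cyc]. *)
have Dx := LK x; set z := K x in Dx.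
have -> : R x y = z.
  apply: (@L_inj (L x y)); rewrite lact_ract_involutive //.
  by rewrite -Dx !cyc.
by rewrite -Dx csl cyc.
Qed.

End SquareFree.

Theorem theorem2p34 (X : Type) (r : X * X -> X * X)
    (qbr : quantum_binomial_set r) :
  [<-> yang_baxter r;
       cond_l1 r;
       cond_l2 r;
       cond_r1 r;
       cond_r2 r;
       cond_lr3 r;
       cond_csl r] /\
  (yang_baxter r -> cyclic_quadratic_set r /\ cond_lri r).
Proof.
have [_ [L_bij R_bij] r_inv r_sqf] := qbr.
have L_inj x : injective (lact r x) := bij_inj (L_bij x).
have R_inj y : injective ((ract r)^~ y) := bij_inj (R_bij y).
have lr3_yb := lr3_yang_baxter r_inv L_inj R_inj.
have l1_lr3 := l1_lr3 r_inv L_inj.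
have r1_lr3 := r1_lr3 r_inv R_inj.
split; last first.
  move=> /yang_baxter_l1/(l1_lri r_inv r_sqf L_bij) lri.
  by split=> //; exact: lri_cyclic.
tfae.
- exact: yang_baxter_l1.
- by move=> l1; apply/l2P; split=> //; exact: l1_lr3.
- by move=> /l2P[_ /lr3_yb]; exact: yang_baxter_r1.
- by move=> r1; apply/r2P; split=> //; exact: r1_lr3.
- by case/r2P.
- by move=> /lr3_yb/yang_baxter_l1; exact: l1_csl.
- by move=> /(csl_l1 r_inv r_sqf L_bij)/l1_lr3.
Qed.
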